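(* There exists a constant $\delta>0$ such that for each integer $m\ge2$, \[\mathrm{BH}^{\mathrm{mult}}_{\ell_{\frac{2m}{m+1},\frac{2(m-1)}{m}}}(m)\le m^{\delta}.\]
   Context: For a finite index set $I$, $1\le p<\infty$, $1\le q<\infty$, the Lorentz (quasi)norm is $\|x\|_{\ell_{p,q}(I)}=\big(\sum_{k}(x_k^* )^q(k^{q/p}-(k-1)^{q/p})\big)^{1/q}$, where $x^*$ is the non-increasing rearrangement of $(|x_i|)_{i\in I}$. Let $\mathcal M(m,n)=\{(i_1,\dots,i_m):1\le i_k\le n\}$. For a complex matrix $a=(a_{\mathbf i})_{\mathbf i\in\mathcal M(m,n)}$, $\|a\|_\infty=\sup\big|\sum_{\mathbf i}a_{\mathbf i}x^1_{i_1}\cdots x^m_{i_m}\big|$ over $x^k\in\mathbb C^n$ with $\sup$-norm $\le1$. For a sequence space $X$ (such as $\ell_{p,q}$, defined on any index set), $\mathrm{BH}^{\mathrm{mult}}_X(m)$ denotes the best constant $C\ge1$ such that $\|(a_{\mathbf i})_{\mathbf i\in\mathcal M(m,n)}\|_{X}\le C\|a\|_\infty$ for every $n$ and every complex matrix $a$ on $\mathcal M(m,n)$. *)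

(* Defs.v *)
From HB Require Import structures.
From mathcomp Require Import all_boot all_order all_algebra.
From mathcomp Require Import all_classical all_reals.
From mathcomp Require Import ereal exp.
From mathcomp Require Import complex.
Set Implicit Arguments. Unset Strict Implicit. Unset Printing Implicit Defensive.
Import Order.TTheory GRing.Theory Num.Theory ComplexField.
Local Open Scope ring_scope.
Local Open Scope classical_set_scope.

Definition multi_index (m n : nat) := (m.-tuple 'I_n)%type.

Definition decr_rearr (R : realType) (I : finType) (x : I -> R[i]) : seq R :=
  sort (fun a b : R => b <= a) [seq ComplexField.Normc.normc (x i) | i <- enum I].

Definition lorentz_norm (R : realType) (p q : R) (I : finType)
    (x : I -> R[i]) : R :=
  let s := decr_rearr x in
  (\sum_(k < size s)
     (nth 0 s k) `^ q * ((k.+1)%:R `^ (q / p) - k%:R `^ (q / p))) `^ q^-1.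

Definition mult_form (R : realType) (m n : nat) (a : multi_index m n -> R[i])
    (xs : 'I_m -> 'I_n -> R[i]) : R[i] :=
  \sum_(i : multi_index m n) a i * \prod_(k < m) xs k (tnth i k).

Definition sup_norm (R : realType) (m n : nat) (a : multi_index m n -> R[i])
    : R :=
  sup [set r : R | exists xs : 'I_m -> 'I_n -> R[i],
         (forall k j, ComplexField.Normc.normc (xs k j) <= 1) /\ r = ComplexField.Normc.normc (mult_form a xs)].

Definition seq_norm (R : realType) := forall I : finType, (I -> R[i]) -> R.

Definition BH_mult_admissible (R : realType) (X : seq_norm R) (m : nat)
    (C : R) : Prop :=
  1 <= C /\ forall (n : nat) (a : multi_index m n -> R[i]),
    X _ a <= C * sup_norm a.

(* BH^mult_X(m): the best (i.e. least) admissible constant, as an extended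
   real (+oo if there is no admissible constant). *)
Definition BH_mult (R : realType) (X : seq_norm R) (m : nat) : \bar R :=
  ereal_inf [set (C%:E)%E | C in BH_mult_admissible X m].

Definition lorentz (R : realType) (p q : R) : seq_norm R :=
  fun I x => lorentz_norm p q x.

(* Main.v *)
(* Put t = 1/m and, for each direction j, let S_j be the sum over the lines in
   direction j of (\sum_line |a|^2)^(1-t), i.e. the q-th power of the
   l_q(l_2)-norm of a, q = 2(m-1)/m.
   Khinchine in one variable, with constant 3^t, and the Bohnenblust-Hille
   inequality in m-1 variables bound every S_j by (m ||a||)^q; the numerical fact
   behind this is 3 (m-1)^(2(m-1)) <= m^(2(m-1)).  Blei's inequality with constant
   1 then gives the l_(2m/(m+1)) Bohnenblust-Hille inequality with constant m, by
   induction.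
   For the Lorentz norm one must bound the sum over x of
   |a_x|^q rank(x)^(-t^2) by a multiple of \sum_j S_j.  Every nonempty set of
   indices has a line on which the weights rank^(-t) of its points sum to at most
   4 (a weighted Loomis-Whitney inequality); removing such lines one after the
   other and applying Hoelder on each of them gives the bound 4 \sum_j S_j.
   Both Blei's inequality and the existence of light lines come from the chain
   rule d = \prod_j d_j for a probability on m-tuples together with AM-GM. *)
Require Import Defs.
From HB Require Import structures.
From mathcomp Require Import all_boot all_order all_algebra.
From mathcomp Require Import all_classical all_reals.
From mathcomp Require Import ereal exp.
From mathcomp Require Import complex.
From mathcomp Require Import ring lra.
Set Implicit Arguments. Unset Strict Implicit. Unset Printing Implicit Defensive.
Import Order.TTheory GRing.Theory Num.Theory.
Local Open Scope ring_scope.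

(** * Hoelder and AM-GM inequalities, lines in the index set *)

Lemma young_powR (R : realType) (t u v : R) : 0 < t -> t < 1 -> 0 <= u -> 0 <= v ->
  u `^ (1 - t) * v `^ t <= (1 - t) * u + t * v.
Proof.
move=> t0 t1 u0 v0; have t1' : 0 < 1 - t by rewrite subr_gt0.
have := @conjugate_powR R (u `^ (1 - t)) (v `^ t) (1 - t)^-1 t^-1.
rewrite !invr_gt0 !invrK -!powRrM !divff ?lt0r_neq0// !powRr1//.
move=> /(_ (powR_ge0 _ _) (powR_ge0 _ _) t1' t0 (subrK _ _)).
by rewrite mulrC [t * v]mulrC [(1 - t) * u]mulrC [_ * u `^ _]mulrC.
Qed.

Lemma hoelder_sum (R : realType) (I : finType) (t : R) (u v : I -> R) :
  0 < t -> t < 1 -> (forall i, 0 <= u i) -> (forall i, 0 <= v i) ->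
  \sum_i u i `^ (1 - t) * v i `^ t <=
    (\sum_i u i) `^ (1 - t) * (\sum_i v i) `^ t.
Proof.
move=> t0 t1 u0 v0; have t1' : 0 < 1 - t by rewrite subr_gt0.
have [A0|An0] := eqVneq (\sum_i u i) 0.
  rewrite big1 ?mulr_ge0 ?powR_ge0// => i _.
  have /eqP := A0; rewrite psumr_eq0// => /allP/(_ i (mem_index_enum i))/= /eqP ->.
  by rewrite powR0 ?mul0r// lt0r_neq0.
have [B0|Bn0] := eqVneq (\sum_i v i) 0.
  rewrite big1 ?mulr_ge0 ?powR_ge0// => i _.
  have /eqP := B0; rewrite psumr_eq0// => /allP/(_ i (mem_index_enum i))/= /eqP ->.
  by rewrite powR0 ?mulr0// lt0r_neq0.
move: An0 Bn0; set A := \sum_i u i; set B := \sum_i v i => An0 Bn0.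
have A0 : 0 < A by rewrite lt0r An0 sumr_ge0.
have B0 : 0 < B by rewrite lt0r Bn0 sumr_ge0.
have -> : A `^ (1 - t) * B `^ t =
    \sum_i A `^ (1 - t) * B `^ t * ((1 - t) * (u i / A) + t * (v i / B)).
  rewrite -big_distrr big_split/= -!big_distrr/= -!big_distrl/= -/A -/B.
  by rewrite !divff// !mulr1 subrK mulr1.
apply: ler_sum => i _.
rewrite -{1}(divfK An0 (u i)) -{1}(divfK Bn0 (v i)).
have uA : 0 <= u i / A by rewrite divr_ge0// ltW.
have vB : 0 <= v i / B by rewrite divr_ge0// ltW.
rewrite (powRM _ uA (ltW A0)) (powRM _ vB (ltW B0)).
rewrite mulrACA mulrC ler_wpM2l ?mulr_ge0 ?powR_ge0//.
exact: young_powR.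
Qed.

Lemma powR_prod (R : realType) (I : finType) (r : R) (d : I -> R) :
  (forall i, 0 <= d i) -> (\prod_i d i) `^ r = \prod_i d i `^ r.
Proof.
move=> d0.
suff [_ ->] : 0 <= \prod_i d i /\ (\prod_i d i) `^ r = \prod_i d i `^ r by [].
apply: (big_rec2 (fun x y => 0 <= x /\ x `^ r = y)); first by rewrite powR1.
by move=> i y x _ [x0 <-]; rewrite powRM// mulr_ge0.
Qed.

Lemma amgm_powR (R : realType) (m : nat) (d : 'I_m.+1 -> R) :
  (forall j, 0 <= d j) ->
  (\prod_j d j) `^ (m.+1%:R^-1) <= (\sum_j d j) / m.+1%:R.
Proof.
move=> d0.
have [+ _] := @leif_AGM R _ [pred x : 'I_m.+1 | true] d (fun i _ => d0 i).
rewrite card_ord => H.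
have m0 : (0 : R) < m.+1%:R by rewrite ltr0n.
have S0 : 0 <= (\sum_j d j) / m.+1%:R by rewrite divr_ge0 ?sumr_ge0 ?ltW.
apply: le_trans (ge0_ler_powR _ _ _ H) _.
- by rewrite invr_ge0 ltW.
- by rewrite nnegrE prodr_ge0.
- by rewrite nnegrE exprn_ge0.
by rewrite -powR_mulrn// -powRrM divff ?lt0r_neq0// powRr1.
Qed.

(** As [t] varies this runs through a line in direction [j]; the pair of [j] and [z] encodes that
    line. *)
Definition insert_coord (m n : nat) (j : 'I_m.+1) (t : 'I_n)
    (z : multi_index m n) : multi_index m.+1 n :=
  [tuple if unlift j k is Some k' then tnth z k' else t | k < m.+1].

Lemma tnth_insert (m n : nat) (j : 'I_m.+1) (t : 'I_n) (z : multi_index m n) :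
  tnth (insert_coord j t z) j = t.
Proof. by rewrite tnth_mktuple unlift_none. Qed.

Lemma tnth_insert_lift (m n : nat) (j : 'I_m.+1) (t : 'I_n)
    (z : multi_index m n) (k : 'I_m) :
  tnth (insert_coord j t z) (lift j k) = tnth z k.
Proof. by rewrite tnth_mktuple liftK. Qed.

Definition drop_coord (m n : nat) (j : 'I_m.+1) (x : multi_index m.+1 n) :
  multi_index m n := [tuple tnth x (lift j k) | k < m].

Lemma insert_coordK (m n : nat) (j : 'I_m.+1) (t : 'I_n) :
  cancel (@insert_coord m n j t) (@drop_coord m n j).
Proof.
by move=> z; apply: eq_from_tnth => k; rewrite tnth_mktuple tnth_insert_lift.
Qed.

Lemma sum_insert (V : nmodType) (m n : nat) (j : 'I_m.+1)
    (F : multi_index m.+1 n -> V) :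
  \sum_x F x = \sum_(z : multi_index m n) \sum_t F (insert_coord j t z).
Proof.
rewrite pair_bigA/=.
rewrite (reindex (fun p : multi_index m n * 'I_n => insert_coord j p.2 p.1))//=.
exists (fun x => (drop_coord j x, tnth x j)).
  by move=> [z t] _ /=; rewrite tnth_insert insert_coordK.
move=> x _ /=; apply: eq_from_tnth => k.
case: (unliftP j k) => [k' ->|->]; last by rewrite tnth_insert.
by rewrite tnth_insert_lift tnth_mktuple.
Qed.

(** * Chain rule and Blei's inequality *)

(** Up to normalisation, the marginal law of the first [k] coordinates, evaluated at those of
    [x]. *)
Definition prefix_mass (R : realType) (m n : nat) (w : multi_index m n -> R)
    (k : nat) (x : multi_index m n) : R :=
  \sum_(y : multi_index m n |
        [forall i : 'I_m, (i < k)%N ==> (tnth y i == tnth x i)]) w y.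

(** Only coordinates before [j] enter the right side, so [t0] is a dummy; splitting that mass by the
    value of coordinate [j] gives the left side. *)
Lemma sum_prefix_mass_insert (R : realType) (m n : nat)
    (w : multi_index m.+1 n -> R) (j : 'I_m.+1) (t0 : 'I_n) (z : multi_index m n) :
  \sum_t prefix_mass w j.+1 (insert_coord j t z) =
    prefix_mass w j (insert_coord j t0 z).
Proof.
rewrite /prefix_mass [RHS](partition_big (fun y => tnth y j) predT)//=.
apply: eq_bigr => t _; apply: eq_bigl => y.
apply/forallP/andP => [H|[/forallP H /eqP yj] i].
  split; last by have := H j; rewrite ltnS leqnn tnth_insert.
  apply/forallP => i; apply/implyP => ij; have := H i; rewrite ltnS ltnW//=.
  by case: (unliftP j i) ij => [k ->|->]; rewrite ?ltnn// !tnth_insert_lift.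
rewrite ltnS leq_eqVlt; apply/implyP => /orP[/eqP/val_inj ->|ij].
  by rewrite yj tnth_insert.
have := H i; rewrite ij/=.
by case: (unliftP j i) ij => [k ->|->]; rewrite ?ltnn// !tnth_insert_lift.
Qed.

(* Chain rule: [d j] is the conditional law of coordinate [j] given the
   preceding ones under the probability proportional to [w]. *)
Lemma chain_rule (R : realType) (m n : nat) (w : multi_index m.+1 n -> R) :
  (forall x, 0 <= w x) ->
  exists d : 'I_m.+1 -> multi_index m.+1 n -> R,
    [/\ forall j x, 0 <= d j x,
        forall j (z : multi_index m n), \sum_t d j (insert_coord j t z) <= 1 &
        forall x, w x = (\sum_y w y) * \prod_j d j x].
Proof.
move=> w0.
have N0 k x : 0 <= prefix_mass w k x by exact: sumr_ge0.
exists (fun j x => prefix_mass w j.+1 x / prefix_mass w j x); split.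
- by move=> j x; rewrite divr_ge0.
(* If the mass [c] is zero, the quotient is 0 by convention; hence an inequality rather than an
   equality. *)
- move=> j z; set c := \sum_t prefix_mass w j.+1 (insert_coord j t z).
  have -> : \sum_t prefix_mass w j.+1 (insert_coord j t z) /
      prefix_mass w j (insert_coord j t z) = c / c.
    rewrite [in RHS]/c mulr_suml; apply: eq_bigr => t _.
    by rewrite -(sum_prefix_mass_insert w j t z).
  by have [->|c0] := eqVneq c 0; rewrite ?mul0r// divff.
move=> x.
have step k : prefix_mass w k x = prefix_mass w 0 x *
    \prod_(0 <= j < k) (prefix_mass w j.+1 x / prefix_mass w j x).
  elim: k => [|k IH]; first by rewrite big_nil mulr1.
  rewrite big_nat_recr//= mulrA -IH.
  (* A zero prefix mass forces the next one to vanish, so the product telescopes in spite of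
     divisions by zero. *)
  have [k0|kn0] := eqVneq (prefix_mass w k x) 0; last by rewrite mulrC divfK.
  rewrite k0 mul0r; apply/eqP; rewrite eq_le N0 andbT -k0.
  rewrite /prefix_mass big_mkcond [leRHS]big_mkcond/=; apply: ler_sum => y _.
  case: ifP => [/forallP H|_]; last by case: ifP.
  suff -> : [forall i : 'I_m.+1, (i < k)%N ==> (tnth y i == tnth x i)] by [].
  apply/forallP => i; apply/implyP => ik.
  by have := H i; rewrite ltnS ltnW.
have <- : prefix_mass w 0 x = \sum_y w y.
  by apply: eq_bigl => y; apply/forallP.
have := step m.+1; rewrite big_mkord => <-.
rewrite /prefix_mass (big_pred1 x)// => y /=.
apply/forallP/eqP => [H|-> i]; last by rewrite eqxx implybT.
by apply: eq_from_tnth => i; apply/eqP; have := H i; rewrite ltn_ord.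
Qed.

(** With [u] the squared moduli and [r = 1 - t] this is the quantity S_j. *)
Definition mixed_sum (R : realType) (m n : nat) (r : R)
    (u : multi_index m.+1 n -> R) (j : 'I_m.+1) : R :=
  \sum_(z : multi_index m n) (\sum_t u (insert_coord j t z)) `^ r.

Lemma invSS_lt1 (R : realType) (m : nat) : (m.+2%:R^-1 : R) < 1.
Proof. by rewrite invf_lt1 ?ltr0n// ltr1n. Qed.

(* Blei's inequality with constant 1.  Let [d j] be the conditional laws of the
   probability [w / Z], where [w] is the summand on the left and [Z] its total
   mass: by AM-GM it suffices to bound the sum of [u `^ (1 - t) * d j `^ t] for
   each [j], which is Hoelder's inequality on the lines in direction [j]. *)
Lemma blei_inequality (R : realType) (m n : nat) (u : multi_index m.+2 n -> R)
    (K : R) (M := m.+2%:R : R) (t := M^-1) :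
  (forall x, 0 <= u x) -> (forall j, mixed_sum (1 - t) u j <= K) ->
  (\sum_x u x `^ (M / (M + 1))) `^ (1 - t ^+ 2) <= K.
Proof.
move=> u0 uK.
have M0 : 0 < M by rewrite ltr0n.
have t0 : 0 < t by rewrite invr_gt0.
have t1 : t < 1 by exact: invSS_lt1.
have Mn0 : M != 0 by rewrite lt0r_neq0.
have M1n0 : M + 1 != 0 by rewrite lt0r_neq0// addr_gt0.
have expE : 1 - t + t ^+ 2 * (M / (M + 1)) = M / (M + 1).
  rewrite /t; clearbody M; field; exact/andP.
have K0 : 0 <= K by apply: le_trans (uK ord0); apply: sumr_ge0 => z _; exact: powR_ge0.
have tt0 : 0 < 1 - t ^+ 2 by rewrite subr_gt0 expr_lt1// ltW.
pose w x := u x `^ (M / (M + 1)).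
have w0 x : 0 <= w x by exact: powR_ge0.
have [d [d0 d1 wd]] := chain_rule w0.
rewrite -/(w _); set Z := \sum_x w x in wd *.
have [->|Zn0] := eqVneq Z 0; first by rewrite powR0// lt0r_neq0.
have Z0 : 0 < Z by rewrite lt0r Zn0 sumr_ge0.
rewrite powRB ?Zn0 ?implybT// powRr1 ?(ltW Z0)//.
rewrite ler_pdivrMr ?powR_gt0//.
(* By [expE], [w = u^(1-t) * w^(t^2)], and the chain rule expands the last factor. Of its two
   exponents [t], the outer serves AM-GM and the inner Hoelder. *)
have ZE : Z = \sum_x (u x `^ (1 - t) * (\prod_j d j x `^ t) `^ t) * Z `^ (t ^+ 2).
  apply: eq_bigr => x _; rewrite -powR_prod// -powRrM -expr2 -mulrA.
  rewrite -powRM ?prodr_ge0 ?(ltW Z0)// [_ * Z]mulrC -wd /w -powRrM.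
  rewrite [_ * t ^+ 2]mulrC -powRD ?expE//.
  by rewrite mulf_eq0 invr_eq0 (negPf Mn0) (negPf M1n0).
rewrite [leLHS]ZE -mulr_suml ler_wpM2r ?powR_ge0//.
apply: (@le_trans _ _ (\sum_x u x `^ (1 - t) * ((\sum_j d j x `^ t) / M))).
  apply: ler_sum => x _; rewrite ler_wpM2l ?powR_ge0//.
  by apply: amgm_powR => j; exact: powR_ge0.
under eq_bigr do rewrite mulrA mulr_sumr.
rewrite -mulr_suml ler_pdivrMr// exchange_big/=.
have -> : K * M = \sum_(j < m.+2) K by rewrite sumr_const card_ord mulr_natr.
apply: ler_sum => j _; apply: le_trans (uK j).
rewrite (sum_insert j); apply: ler_sum => z _.
apply: le_trans (hoelder_sum _ _ _ _) _ => //.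
rewrite -[leRHS]mulr1 ler_wpM2l ?powR_ge0//.
apply: le_trans (_ : 1 `^ t <= _); last by rewrite powR1.
by rewrite ge0_ler_powR ?nnegrE ?sumr_ge0 ?(ltW t0).
Qed.

(** Induction: after multiplication by [(N+1)^t], Young bounds [N^(1-t) * (N+1)^t] by [N + t], and
    [2 * t <= 1] closes the step. *)
Lemma sum_powRN_le (R : realType) (t : R) (N : nat) : 0 < t -> t <= 2^-1 ->
  \sum_(k < N) k.+1%:R `^ (- t) <= 2 * N%:R `^ (1 - t).
Proof.
move=> t0 t2; elim: N => [|N IH].
  by rewrite big_ord0 mulr_ge0 ?powR_ge0.
rewrite big_ord_recr/=; apply: le_trans (lerD IH (lexx _)) _.
have N0 : (0 : R) < N.+1%:R by rewrite ltr0n.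
have t1 : t < 1 by lra.
have := young_powR t0 t1 (ler0n R N) (ltW N0).
have -> : (N.+1%:R : R) `^ (1 - t) = N.+1%:R * N.+1%:R `^ (- t).
  by rewrite powRD ?lt0r_neq0 ?implybT// powRr1// ltW.
have P0 : 0 < (N.+1%:R : R) `^ t by rewrite powR_gt0.
have Pn0 := lt0r_neq0 P0.
rewrite powRN; set P := _ `^ t in P0 Pn0 *; set Q := _ `^ (1 - t) => H.
rewrite -(ler_pM2r P0).
have -> : (2 * Q + P^-1) * P = 2 * (Q * P) + 1 by field.
have -> : 2 * (N.+1%:R / P) * P = 2 * N.+1%:R by field.
move: H; rewrite -natr1; have : t * 2 <= 1 by lra.
lra.
Qed.

(** Split at rank [N = #|F|]: the smaller ranks give at most [2 * N^(1-t)], the at most [N] others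
    at most [N^(-t)] each. *)
Lemma sum_rank_le (R : realType) (I : finType) (rank : I -> nat) (t : R)
    (F : {set I}) : injective rank -> 0 < t -> t <= 2^-1 ->
  \sum_(x in F) (rank x).+1%:R `^ (- t) <= 3 * #|F|%:R `^ (1 - t).
Proof.
move=> inj t0 t2; set N := #|F|; have t1 : t < 1 by lra.
have [N0|Nn0] := eqVneq N 0%N.
  move: (N0) => /eqP; rewrite cards_eq0 => /eqP ->.
  by rewrite big_set0 mulr_ge0 ?powR_ge0.
have N0 : (0 : R) < N%:R by rewrite ltr0n lt0n.
rewrite (bigID (fun x => (rank x < N)%N))/=.
have -> : 3 * N%:R `^ (1 - t) = 2 * N%:R `^ (1 - t) + N%:R * N%:R `^ (- t) :> R.
  rewrite powRD ?lt0r_neq0 ?implybT// powRr1 ?ltW//; lra.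
apply: lerD.
  apply: le_trans (sum_powRN_le N t0 t2).
  have -> : \sum_(x in F | (rank x < N)%N) ((rank x).+1%:R : R) `^ (- t) =
      \sum_(k < N) \sum_(x in F | rank x == k) k.+1%:R `^ (- t).
    rewrite (exchange_big_dep (mem F))/=; last by move=> k x _ /andP[].
    rewrite big_mkcondr/=; apply: eq_bigr => x xF.
    case: ifPn => [xN|xN].
      rewrite (big_pred1 (Ordinal xN))// => k /=.
      by rewrite xF/= eq_sym -val_eqE.
    rewrite big_pred0// => k; rewrite xF/=.
    by apply/negP => /eqP H; rewrite H ltn_ord in xN.
  apply: ler_sum => k _.
  have [x /andP[xF /eqP xk]|H] := pickP (fun x => (x \in F) && (rank x == k)).
    rewrite (big_pred1 x)// => y /=.
    apply/andP/eqP => [[_ /eqP yk]|->]; last by rewrite xF xk.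
    by apply: inj; rewrite xk.
  by rewrite big_pred0// powR_ge0.
apply: le_trans (_ : \sum_(x in F) N%:R `^ (- t) <= _).
  rewrite big_mkcondr/=; apply: ler_sum => x xF.
  case: ifPn; last by rewrite powR_ge0.
  rewrite -leqNgt => Nx; rewrite !powRN lef_pV2 ?posrE ?powR_gt0//.
  by rewrite ge0_ler_powR ?nnegrE ?(ltW t0)// ler_nat ltnW.
by rewrite sumr_const mulr_natl.
Qed.

(** * Light lines and the Lorentz weights *)

(* If every line meeting [F] carried weight more than 4, then the conditional
   laws [d j] of the uniform probability on [F] would have
   [\sum_(x in F) d j x <= #|{lines in direction j meeting F}|
     <= (\sum_(x in F) weight x) / 4], contradicting the AM-GM bound
   [#|F| `^ (1 - t) <= t * \sum_j \sum_(x in F) d j x]. *)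
Lemma light_line (R : realType) (m n : nat)
    (rank : multi_index m.+2 n -> nat) (F : {set multi_index m.+2 n})
    (M := m.+2%:R : R) (t := M^-1) : injective rank -> F != finset.set0 ->
  exists p : 'I_m.+2 * multi_index m.+1 n,
    [exists s, insert_coord p.1 s p.2 \in F] /\
    \sum_s (if insert_coord p.1 s p.2 \in F
            then (rank (insert_coord p.1 s p.2)).+1%:R `^ (- t) else 0) <= 4.
Proof.
move=> inj F0; apply: contrapT => noline.
have M0 : 0 < M by rewrite ltr0n.
have t0 : 0 < t by rewrite invr_gt0.
have t2 : t <= 2^-1 by rewrite lef_pV2 ?posrE ?ltr0n// ler_nat.
have N0 : (0 : R) < #|F|%:R by rewrite ltr0n card_gt0.
have [d [d0 d1 wd]] := @chain_rule R m.+1 n (fun x => (x \in F)%:R)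
  (fun x => ler0n _ _).
have sumF : \sum_(y : multi_index m.+2 n) (y \in F)%:R = #|F|%:R :> R.
  by rewrite -natr_sum -big_mkcond sum1_card.
have heavy j (z : multi_index m.+1 n) :
    \sum_s (if insert_coord j s z \in F then d j (insert_coord j s z) else 0)
    <= (\sum_s (if insert_coord j s z \in F
            then (rank (insert_coord j s z)).+1%:R `^ (- t) else 0)) / 4.
  case: (boolP [exists s, insert_coord j s z \in F]) => [ex|].
    apply: (@le_trans _ _ 1).
      by apply: le_trans (d1 j z); apply: ler_sum => s _; case: ifP.
    rewrite ler_pdivlMr ?mul1r ?ltr0n//; rewrite leNgt; apply/negP => lt4.
    by apply: noline; exists (j, z); split => //; exact: ltW.
  rewrite negb_exists => /forallP H.
  by rewrite !big1 ?mul0r// => s _; rewrite (negPf (H s)).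
(* The 3 comes from [sum_rank_le], the 4 from the threshold for heavy lines; a ratio below 1 yields
   the contradiction. *)
have sumd j : \sum_(x in F) d j x <= 3 / 4 * #|F|%:R `^ (1 - t).
  rewrite big_mkcond (sum_insert j)/=.
  apply: le_trans (ler_sum _ (fun z _ => heavy j z)) _.
  rewrite -mulr_suml.
  rewrite -(sum_insert j (fun x =>
    if x \in F then (rank x).+1%:R `^ (- t) else 0)) -big_mkcond/=.
  have := sum_rank_le F inj t0 t2; lra.
(* On [F] the chain rule reads [1 = #|F| * \prod_j d j x]; its [t]-th power is bounded by AM-GM. *)
have key : #|F|%:R <= #|F|%:R `^ t * (3 / 4 * #|F|%:R `^ (1 - t)) :> R.
  apply: (@le_trans _ _ (\sum_(x in F) #|F|%:R `^ t * ((\sum_j d j x) / M))).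
    rewrite -{1}sum1_card natr_sum; apply: ler_sum => x xF.
    have -> : 1%:R = (#|F|%:R * \prod_j d j x) `^ t.
      by rewrite -sumF -wd xF powR1.
    by rewrite powRM ?prodr_ge0 ?ler0n// ler_wpM2l ?powR_ge0 ?amgm_powR.
  rewrite -mulr_sumr ler_wpM2l ?powR_ge0// -mulr_suml ler_pdivrMr//.
  rewrite exchange_big/=.
  apply: le_trans (ler_sum _ (fun j _ => sumd j)) _.
  by rewrite sumr_const card_ord mulr_natr.
have : #|F|%:R `^ t * #|F|%:R `^ (1 - t) = #|F|%:R :> R.
  by rewrite -powRD ?lt0r_neq0 ?implybT// addrC subrK powRr1// ltW.
move: key N0; lra.
Qed.

Lemma sum_line (V : nmodType) (m n : nat) (j : 'I_m.+1) (z : multi_index m n)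
    (F : multi_index m.+1 n -> V) :
  \sum_(x | drop_coord j x == z) F x = \sum_t F (insert_coord j t z).
Proof.
rewrite big_mkcond (sum_insert j) (bigD1 z)//= [X in _ + X]big1 ?addr0.
  by apply: eq_bigr => t _; rewrite insert_coordK eqxx.
by move=> z' /negPf zz; rewrite big1// => t _; rewrite insert_coordK zz.
Qed.

(* Greedy removal of light lines; each line is removed at most once. *)
Lemma sum_rank_mixed (R : realType) (m n : nat)
    (rank : multi_index m.+2 n -> nat) (u : multi_index m.+2 n -> R)
    (M := m.+2%:R : R) (t := M^-1) : injective rank -> (forall x, 0 <= u x) ->
  \sum_x u x `^ (1 - t) * (rank x).+1%:R `^ (- t ^+ 2) <=
    4 * \sum_j mixed_sum (1 - t) u j.
Proof.
move=> inj u0.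
have t0 : 0 < t by rewrite invr_gt0 ltr0n.
have t1 : t < 1 by exact: invSS_lt1.
pose c x : R := (rank x).+1%:R `^ (- t).
pose L (p : 'I_m.+2 * multi_index m.+1 n) :=
  (\sum_s u (insert_coord p.1 s p.2)) `^ (1 - t).
pose meets (F : {set multi_index m.+2 n}) (p : 'I_m.+2 * multi_index m.+1 n) :=
  [exists s, insert_coord p.1 s p.2 \in F].
have L0 p : 0 <= L p by exact: powR_ge0.
(* Only lines meeting [F] are counted on the right, so the term of a removed line pays for its
   points and is never charged again. *)
have greedy k : forall F : {set multi_index m.+2 n}, (#|F| <= k)%N ->
    \sum_(x in F) u x `^ (1 - t) * c x `^ t <=
    4 * \sum_p (if meets F p then L p else 0).
  elim: k => [|k IH] F Fk.
    move: Fk; rewrite leqn0 cards_eq0 => /eqP ->.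
    by rewrite big_set0 mulr_ge0// sumr_ge0// => p _; case: ifP.
  have [->|F0] := eqVneq F finset.set0.
    by rewrite big_set0 mulr_ge0// sumr_ge0// => p _; case: ifP.
  have [p [pF lightp]] := light_line R inj F0.
  pose F' := [set x in F | drop_coord p.1 x != p.2]%SET.
  have F'F : F' \proper F.
    apply/properP; split; first by apply/fintype.subsetP => x; rewrite inE => /andP[].
    have [s sF] := existsP pF; exists (insert_coord p.1 s p.2) => //.
    by rewrite inE insert_coordK eqxx andbF.
  have F'k : (#|F'| <= k)%N by rewrite -ltnS; exact: leq_trans (proper_card F'F) Fk.
  rewrite (bigID (fun x => drop_coord p.1 x == p.2))/= (bigD1 p)//= /meets pF.
  rewrite mulrDr; apply: lerD.
    rewrite big_mkcondl sum_line/=.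
    apply: (@le_trans _ _ (\sum_s u (insert_coord p.1 s p.2) `^ (1 - t) *
        (if insert_coord p.1 s p.2 \in F then c (insert_coord p.1 s p.2)
         else 0) `^ t)).
      apply: ler_sum => s _; case: ifP => // _.
      by rewrite mulr_ge0 ?powR_ge0.
    apply: le_trans (hoelder_sum _ _ _ _) _ => //.
      by move=> s; case: ifP => // _; exact: powR_ge0.
    rewrite mulrC ler_wpM2r ?powR_ge0//.
    apply: (@le_trans _ _ (4 `^ t)).
      rewrite ge0_ler_powR ?nnegrE ?(ltW t0)//.
      by apply: sumr_ge0 => s _; case: ifP => // _; exact: powR_ge0.
    by rewrite ler1_powR ?ler1n// ltW.
  have := IH _ F'k.
  rewrite (eq_bigl (fun x => (x \in F) && (drop_coord p.1 x != p.2))); last first.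
    by move=> x; rewrite inE.
  move=> H; apply: le_trans H _; rewrite ler_wpM2l//.
  rewrite (bigD1 p)//= ifN; last first.
    by apply/existsPn => s; rewrite inE insert_coordK eqxx andbF.
  rewrite add0r; apply: ler_sum => q _.
  case: ifP => [/existsP[s]|_]; last by case: ifP.
  rewrite inE => /andP[sF _]; rewrite ifT//; apply/existsP; by exists s.
have := greedy _ finset.setT (leqnn _).
rewrite (eq_bigl predT) => [|x]; last by rewrite inE.
under eq_bigr do rewrite -powRrM mulNr -expr2.
move=> H; apply: le_trans H _; rewrite ler_wpM2l//.
rewrite /mixed_sum pair_bigA/=; apply: ler_sum => p _.
by case: ifP => // _; exact: powR_ge0.
Qed.

(** * Khinchine's inequality *)

Local Notation normc := ComplexField.Normc.normc.

Definition normc2 (R : realType) (z : R[i]) : R := normc z ^+ 2.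

Lemma normc2E (R : realType) (z : R[i]) : normc2 z = complex.Re z ^+ 2 + complex.Im z ^+ 2.
Proof. by case: z => x y; rewrite /normc2 /= sqr_sqrtr// addr_ge0 ?sqr_ge0. Qed.

Lemma normc2_ge0 (R : realType) (z : R[i]) : 0 <= normc2 z.
Proof. by rewrite normc2E addr_ge0 ?sqr_ge0. Qed.

Lemma normc_ge0 (R : realType) (z : R[i]) : 0 <= normc z.
Proof. by case: z => x y; rewrite /= sqrtr_ge0. Qed.

Lemma normc2D_normc2B (R : realType) (f b : R[i]) :
  normc2 (f + b) + normc2 (f - b) = 2 * (normc2 f + normc2 b).
Proof. by case: f b => [f1 f2] [b1 b2]; rewrite !normc2E /=; ring. Qed.

(** Cauchy-Schwarz for the real part of [f] times the conjugate of [b]. The coefficient 6 is twice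
    the 3 of the fourth-moment bound, which lets that constant pass through the induction. *)
Lemma sqr_normc2D_normc2B (R : realType) (f b : R[i]) :
  normc2 (f + b) ^+ 2 + normc2 (f - b) ^+ 2 <=
    2 * (normc2 f ^+ 2 + 6 * (normc2 f * normc2 b) + normc2 b ^+ 2).
Proof.
case: f b => [f1 f2] [b1 b2]; rewrite !normc2E /= -subr_ge0.
have -> : 2 * ((f1 ^+ 2 + f2 ^+ 2) ^+ 2 +
    6 * ((f1 ^+ 2 + f2 ^+ 2) * (b1 ^+ 2 + b2 ^+ 2)) + (b1 ^+ 2 + b2 ^+ 2) ^+ 2) -
    (((f1 + b1) ^+ 2 + (f2 + b2) ^+ 2) ^+ 2 +
     ((f1 - b1) ^+ 2 + (f2 - b2) ^+ 2) ^+ 2) = 8 * (f1 * b2 - f2 * b1) ^+ 2.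
  by ring.
by rewrite mulr_ge0// sqr_ge0.
Qed.

Definition flip (I : finType) (i : I) (e : {ffun I -> bool}) : {ffun I -> bool} :=
  [ffun k => e k (+) (k == i)].

Lemma flipK (I : finType) (i : I) : involutive (flip i).
Proof. by move=> e; apply/ffunP => k; rewrite !ffunE addbK. Qed.

(** Signs are indexed by all of [I], so that induction on [s] keeps a single probability space. *)
Definition sign_sum (R : realType) (I : finType) (a : I -> R[i]) (s : seq I)
    (e : {ffun I -> bool}) : R[i] := \sum_(k <- s) a k * (-1) ^+ e k.

Lemma sign_sum_flip (R : realType) (I : finType) (a : I -> R[i]) (i : I)
    (s : seq I) (e : {ffun I -> bool}) :
  i \notin s -> sign_sum a s (flip i e) = sign_sum a s e.
Proof.
move=> is_; apply: eq_big_seq => k ks; rewrite ffunE.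
by have [ki|_] := eqVneq k i; [rewrite -ki ks in is_ | rewrite addbF].
Qed.

(** Flipping the sign at [i] permutes the sign vectors and fixes the sum over [s]; each [e] is
    averaged with its flip. *)
Lemma sign_sum_cons (R : realType) (I : finType) (a : I -> R[i]) (i : I)
    (s : seq I) (G : R[i] -> R) : i \notin s ->
  2 * \sum_e G (sign_sum a (i :: s) e) =
    \sum_(e : {ffun I -> bool}) (G (sign_sum a s e + a i) + G (sign_sum a s e - a i)).
Proof.
move=> is_; rewrite mulr_natl mulr2n.
rewrite {2}(reindex_inj (inv_inj (flipK i))) -big_split/=.
apply: eq_bigr => e _; rewrite /sign_sum !big_cons -!/(sign_sum _ _ _).
rewrite sign_sum_flip// ffunE eqxx addbT.
case: (e i); rewrite /= ?expr1 ?expr0 ?mulr1 ?mulrN1.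
  by rewrite [RHS]addrC; congr (G _ + G _); rewrite addrC.
by congr (G _ + G _); rewrite addrC.
Qed.

Lemma sign_sum_moments (R : realType) (I : finType) (a : I -> R[i]) (s : seq I)
    (N := #|{ffun I -> bool}|%:R : R) (S := \sum_(k <- s) normc2 (a k)) :
  uniq s ->
  \sum_e normc2 (sign_sum a s e) = N * S /\
  \sum_e normc2 (sign_sum a s e) ^+ 2 <= 3 * (N * S ^+ 2).
Proof.
rewrite {}/S; elim: s => [_|i s IH /= /andP[is_ us]].
  rewrite big_nil expr0n/= !mulr0; split.
    by rewrite big1// => e _; rewrite /sign_sum big_nil normc2E/= expr0n/= addr0.
  rewrite big1// => e _.
  by rewrite /sign_sum big_nil normc2E/= expr0n/= addr0 expr0n.
have [IH2 IH4] := IH us; rewrite big_cons.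
set S := \sum_(k <- s) _ in IH2 IH4 *; set A := normc2 (a i).
have A0 : 0 <= A by exact: normc2_ge0.
have N0 : 0 <= N by exact: ler0n.
have sumA (c : R) : \sum_(e : {ffun I -> bool}) c = N * c.
  by rewrite sumr_const mulr_natl.
split.
  have := sign_sum_cons a (@normc2 R) is_.
  under [in RHS]eq_bigr do rewrite normc2D_normc2B.
  by rewrite -mulr_sumr big_split/= IH2 sumA -/A; lra.
have := sign_sum_cons a (fun z => normc2 z ^+ 2) is_ => /= H.
have : 2 * (\sum_e normc2 (sign_sum a (i :: s) e) ^+ 2) <=
    \sum_e 2 * (normc2 (sign_sum a s e) ^+ 2 +
                6 * (normc2 (sign_sum a s e) * A) + A ^+ 2).
  by rewrite H; apply: ler_sum => e _; exact: sqr_normc2D_normc2B.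
rewrite -mulr_sumr !big_split/= -mulr_sumr -mulr_suml IH2 sumA => {}H.
have : 0 <= N * A ^+ 2 by rewrite mulr_ge0// sqr_ge0.
have -> : 3 * (N * (A + S) ^+ 2) =
  3 * (N * A ^+ 2) + 6 * (N * S * A) + 3 * (N * S ^+ 2) by ring.
lra.
Qed.

(* Khinchine's inequality between the exponents [2 - 2t] and [2], by Hoelder
   interpolation of the second moment between the exponents [2 - 2t] and [4]. *)
Lemma khinchine (R : realType) (I : finType) (a : I -> R[i]) (t : R)
    (N := #|{ffun I -> bool}|%:R : R) : 0 < t -> t < 1 ->
  N * (\sum_k normc2 (a k)) `^ (1 - t) <=
    3 `^ t * \sum_(e : {ffun I -> bool})
               normc2 (\sum_k a k * (-1) ^+ e k) `^ (1 - t).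
Proof.
move=> t0 t1; set S := \sum_k _.
have [m2 m4] := sign_sum_moments a (index_enum_uniq I).
rewrite -/N -/S in m2 m4.
pose g e := normc2 (sign_sum a (index_enum I) e).
have g0 e : 0 <= g e by exact: normc2_ge0.
have N0 : 0 < N.
  by rewrite ltr0n; apply/card_gt0P; exists [ffun=> true].
have S0' : 0 <= S by apply: sumr_ge0 => k _; exact: normc2_ge0.
rewrite -/(sign_sum _ _ _) -[X in _ <= _ * X]/(\sum_e g e `^ (1 - t)).
set T := \sum_e g e `^ (1 - t).
have T0 : 0 <= T by apply: sumr_ge0 => e _; exact: powR_ge0.
have t10 : 0 < 1 - t by rewrite subr_gt0.
have [->|Sn0] := eqVneq S 0.
  by rewrite powR0 ?lt0r_neq0// mulr0 mulr_ge0 ?powR_ge0.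
have S0 : 0 < S by rewrite lt0r Sn0.
have tp : 0 < 1 + t by rewrite addr_gt0.
have tpn := lt0r_neq0 tp.
(* The solution of [(1 - t) * (1 - h) + 2 * h = 1]. Afterwards the power [1 + t] is taken and
   [N^t * S^(2t)] cancelled. *)
pose h := t / (1 + t).
have h0 : 0 < h by rewrite divr_gt0.
have h1 : h < 1 by rewrite ltr_pdivrMr// mul1r ltrDr.
have hE : 1 - h = (1 + t)^-1 by rewrite /h; field.
have : N * S <= T `^ (1 - h) * (3 * (N * S ^+ 2)) `^ h.
  rewrite -m2.
  have -> : \sum_e normc2 (sign_sum a (index_enum I) e) =
      \sum_e (g e `^ (1 - t)) `^ (1 - h) * (g e ^+ 2) `^ h.
    apply: eq_bigr => e _; rewrite -/(g e) -powR_mulrn// -!powRrM hE.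
    have E : (1 - t) * (1 + t)^-1 + 2%:R * h = 1 by rewrite /h; field.
    by rewrite -powRD E ?powRr1// oner_eq0.
  apply: le_trans (hoelder_sum h0 h1 _ _) _.
  - by move=> e; exact: powR_ge0.
  - by move=> e; rewrite exprn_ge0.
  rewrite ler_wpM2l ?powR_ge0// ge0_ler_powR ?nnegrE ?(ltW h0)//.
    by apply: sumr_ge0 => e _; rewrite exprn_ge0.
  by rewrite mulr_ge0// mulr_ge0 ?exprn_ge0 ?ltW.
move/(ge0_ler_powR (ltW tp)); rewrite !nnegrE.
rewrite !(mulr_ge0, powR_ge0, ltW N0, ltW S0)// => /(_ isT isT).
rewrite powRM ?(ltW N0) ?(ltW S0)//.
rewrite powRM ?powR_ge0// -!powRrM hE mulVf// powRr1// /h divfK//.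
rewrite powRM ?mulr_ge0 ?exprn_ge0 ?(ltW N0) ?(ltW S0)//.
rewrite powRM ?exprn_ge0 ?(ltW N0) ?(ltW S0)//.
rewrite -[S ^+ 2]powR_mulrn ?(ltW S0)// -powRrM.
have -> : N `^ (1 + t) = N * N `^ t.
  by rewrite powRD ?lt0r_neq0 ?implybT// powRr1// ltW.
have -> : S `^ (1 + t) = S `^ (1 - t) * S `^ (2%:R * t).
  rewrite -powRD ?lt0r_neq0 ?implybT//; congr (_ `^ _); lra.
have Nt : 0 < N `^ t by rewrite powR_gt0.
have St : 0 < S `^ (2%:R * t) by rewrite powR_gt0.
move=> H; rewrite -(ler_pM2r (mulr_gt0 Nt St)).
move: H; congr (_ <= _); ring.
Qed.

(** * The Bohnenblust-Hille inequality *)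

Lemma normc_sum_le (R : realType) (I : finType) (F : I -> R[i]) :
  normc (\sum_i F i) <= \sum_i normc (F i).
Proof.
apply: (big_rec2 (fun x y => normc x <= y)) => [|i y x _ xy].
  by rewrite ComplexField.Normc.normc0.
by apply: le_trans (le_normcD _ _) _; rewrite lerD2l.
Qed.

Lemma normc_prod_le1 (R : realType) (I : finType) (F : I -> R[i]) :
  (forall i, normc (F i) <= 1) -> normc (\prod_i F i) <= 1.
Proof.
move=> F1; apply: (big_ind (fun x => normc x <= 1)) => //; first by rewrite ComplexField.Normc.normc1.
move=> x y x1 y1; rewrite ComplexField.Normc.normcM -[leRHS]mulr1.
by apply: ler_pM => //; exact: normc_ge0.
Qed.

(** A real [sup] dominates its set only when that set is bounded; the sum of the moduli of the
    coefficients bounds it here. *)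
Lemma mult_form_le_sup_norm (R : realType) (m n : nat)
    (a : multi_index m n -> R[i]) (xs : 'I_m -> 'I_n -> R[i]) :
  (forall k j, normc (xs k j) <= 1) -> normc (mult_form a xs) <= sup_norm a.
Proof.
move=> xs1; apply: ub_le_sup; last by exists xs.
exists (\sum_x normc (a x)) => _ [ys [ys1 ->]].
apply: le_trans (normc_sum_le _) _; apply: ler_sum => x _.
rewrite ComplexField.Normc.normcM -[leRHS]mulr1 ler_wpM2l ?normc_ge0//.
exact: normc_prod_le1.
Qed.

Lemma sup_norm_ge0 (R : realType) (m n : nat) (a : multi_index m n -> R[i]) :
  0 <= sup_norm a.
Proof.
apply: le_trans (@mult_form_le_sup_norm _ _ _ a (fun _ _ => 0) _).
  exact: normc_ge0.
by move=> _ _; rewrite ComplexField.Normc.normc0.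
Qed.

Lemma sup_norm_slice (R : realType) (m n : nat) (a : multi_index m.+1 n -> R[i])
    (j : 'I_m.+1) (v : 'I_n -> R[i]) : (forall t, normc (v t) <= 1) ->
  sup_norm (fun z => \sum_t a (insert_coord j t z) * v t) <= sup_norm a.
Proof.
move=> v1; apply: ge_sup.
  by exists (normc (mult_form (fun z => \sum_t a (insert_coord j t z) * v t)
    (fun _ _ => 0))), (fun _ _ => 0); split => // _ _; rewrite ComplexField.Normc.normc0.
move=> _ [ys [ys1 ->]].
pose xs (k : 'I_m.+1) t := if unlift j k is Some k' then ys k' t else v t.
have -> : mult_form (fun z => \sum_t a (insert_coord j t z) * v t) ys =
    mult_form a xs.
  rewrite /mult_form (sum_insert j); apply: eq_bigr => z _.
  rewrite big_distrl/=; apply: eq_bigr => t _.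
  rewrite (bigD1_ord j)//= /xs unlift_none tnth_insert mulrA; congr (_ * _).
  by apply: eq_bigr => k _; rewrite liftK tnth_insert_lift.
apply: mult_form_le_sup_norm => k t; rewrite /xs.
by case: unlift.
Qed.

Lemma phase (R : realType) (z : R[i]) :
  exists2 w : R[i], normc w <= 1 & z * w = real_complex R (normc z).
Proof.
have [->|z0] := eqVneq z 0.
  by exists 0; rewrite ComplexField.Normc.normc0 ?mul0r.
have nz0 : normc z != 0.
  by apply: contra z0 => /eqP/ComplexField.Normc.eq0_normc ->.
exists (real_complex R (normc z) / z); last by rewrite mulrC divfK.
rewrite ComplexField.Normc.normcM ComplexField.Normc.normcV.
rewrite /= [X in Num.sqrt X](_ : _ = normc z ^+ 2); last by rewrite expr0n addr0.
by rewrite sqrtr_sqr ger0_norm ?normc_ge0// divff.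
Qed.

(** Base case of the induction: phases chosen coordinatewise make all terms of a linear form
    nonnegative. *)
Lemma sum_normc_le_sup_norm (R : realType) (n : nat) (a : multi_index 1 n -> R[i]) :
  \sum_x normc (a x) <= sup_norm a.
Proof.
have [w w1 wE] : exists2 w : 'I_n -> R[i], (forall t, normc (w t) <= 1) &
    forall t, a [tuple t] * w t = real_complex R (normc (a [tuple t])).
  have /choice[w wP] : forall t, exists w, normc w <= 1 /\
      a [tuple t] * w = real_complex R (normc (a [tuple t])).
    by move=> t; have [w] := phase (a [tuple t]); exists w.
  by exists w => t; case: (wP t).
have := @mult_form_le_sup_norm _ _ _ a (fun _ => w) (fun _ => w1).
apply: le_trans.
rewrite /mult_form.
have -> : \sum_(i : multi_index 1 n) a i * \prod_(k < 1) w (tnth i k) =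
    real_complex R (\sum_x normc (a x)).
  rewrite rmorph_sum; apply: eq_bigr => x _; rewrite big_ord1.
  have {1 3}-> : x = [tuple tnth x ord0].
    by apply: eq_from_tnth => k; rewrite ord1.
  by rewrite wE.
rewrite /= expr0n addr0 sqrtr_sqr; exact: ler_norm.
Qed.

(** Two binomial terms give [2 * k^k <= (k+1)^k]; squaring yields the factor 4. *)
Lemma three_mul_expn_le (k : nat) : (0 < k)%N ->
  (3 * k ^ (2 * k) <= k.+1 ^ (2 * k))%N.
Proof.
move=> k0; rewrite ![(2 * k)%N]mulnC !expnM.
have H : (2 * k ^ k <= k.+1 ^ k)%N.
  rewrite -[k.+1]addn1 expnDn.
  case: k k0 => // k _; rewrite big_ord_recl big_ord_recl/=.
  rewrite !exp1n !muln1 subn0 bin0 mul1n/= /bump/= add1n bin1 subSS subn0 -expnS.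
  by rewrite mul2n -addnn addnA leq_addr.
have : ((2 * k ^ k) ^ 2 <= (k.+1 ^ k) ^ 2)%N by rewrite leq_exp2r.
by rewrite expnMn; apply: leq_trans; rewrite leq_mul2r orbT.
Qed.

(** The [t]-th power of [three_mul_expn_le] at [k = m.+1]: the growth of the constant from [m.+1] to
    [m.+2] absorbs Khinchine's [3^t]. *)
Lemma three_powR_le (R : realType) (m : nat) (M := m.+2%:R : R) (t := M^-1) :
  3 `^ t * m.+1%:R `^ (2 * (1 - t)) <= M `^ (2 * (1 - t)).
Proof.
have M0 : 0 < M by rewrite ltr0n.
have -> : 2 * (1 - t) = (2 * m.+1)%:R * t.
  have -> : (2 * m.+1)%:R = 2 * (M - 1) :> R by rewrite natrM /M -[m.+2]addn1 natrD addrK.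
  by rewrite -mulrA mulrBl mul1r mulfV ?lt0r_neq0.
rewrite !powRrM !powR_mulrn ?ler0n// -powRM ?exprn_ge0//.
rewrite ge0_ler_powR ?nnegrE ?invr_ge0 ?(ltW M0) ?exprn_ge0 ?mulr_ge0//.
by rewrite -!natrX -natrM ler_nat three_mul_expn_le.
Qed.

(** The Bohnenblust-Hille inequality with constant [m], raised to its exponent [2m/(m+1)] to avoid
    roots. *)
Definition bh_bound (R : realType) (m : nat) : Prop :=
  forall (n : nat) (a : multi_index m n -> R[i]),
    \sum_x normc2 (a x) `^ (m%:R / (m%:R + 1)) <=
      (m%:R * sup_norm a) `^ (2 * (m%:R / (m%:R + 1))).

(** Random signs in variable [j] turn each line sum into an average over slices, to which the bound
    in one variable fewer applies. *)
Lemma mixed_sum_le (R : realType) (m n : nat) (a : multi_index m.+2 n -> R[i])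
    (j : 'I_m.+2) (M := m.+2%:R : R) (t := M^-1) : bh_bound R m.+1 ->
  mixed_sum (1 - t) (fun x => normc2 (a x)) j <=
    (M * sup_norm a) `^ (2 * (1 - t)).
Proof.
move=> bh.
have M0 : 0 < M by rewrite ltr0n.
have t0 : 0 < t by rewrite invr_gt0.
have t1 : t < 1 by exact: invSS_lt1.
(* The Bohnenblust-Hille exponent in [m.+1] variables is exactly the outer exponent of the mixed
   sum. *)
have tE : m.+1%:R / (m.+1%:R + 1) = 1 - t.
  by rewrite natr1 -/M -[m.+1%:R](addrK 1) natr1 -/M mulrBl mul1r divff ?lt0r_neq0.
set N := #|{ffun 'I_n -> bool}|%:R : R.
have N0 : 0 < N.
  by rewrite ltr0n; apply/card_gt0P; exists [ffun=> true].
rewrite -(ler_pM2l N0) /mixed_sum mulr_sumr.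
apply: (@le_trans _ _ (3 `^ t * \sum_(e : {ffun 'I_n -> bool}) \sum_z
    normc2 (\sum_s a (insert_coord j s z) * (-1) ^+ e s) `^ (1 - t))).
  rewrite exchange_big mulr_sumr/=; apply: ler_sum => z _.
  exact: (khinchine (fun s => a (insert_coord j s z)) t0 t1).
apply: (@le_trans _ _ (3 `^ t * \sum_(e : {ffun 'I_n -> bool})
    (m.+1%:R * sup_norm a) `^ (2 * (1 - t)))).
  rewrite ler_wpM2l ?powR_ge0//; apply: ler_sum => e _.
  have := bh _ (fun z => \sum_s a (insert_coord j s z) * (-1) ^+ e s).
  rewrite tE => H; apply: le_trans H _.
  rewrite ge0_ler_powR ?nnegrE ?mulr_ge0 ?sup_norm_ge0 ?subr_ge0 ?(ltW t1)//.
  rewrite ler_wpM2l// sup_norm_slice// => s.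
  case: (e s); rewrite ?expr1 ?expr0 ?normcN ComplexField.Normc.normc1//.
set X := _ `^ (2 * (1 - t)).
have -> : \sum_(e : {ffun 'I_n -> bool}) X = N * X.
  by rewrite sumr_const mulr_natl.
rewrite mulrCA {}/X ler_wpM2l ?(ltW N0)//.
rewrite !powRM ?ler0n ?sup_norm_ge0// mulrA ler_wpM2r ?powR_ge0//.
exact: three_powR_le.
Qed.

Lemma bohnenblust_hille (R : realType) (m : nat) : bh_bound R m.+1.
Proof.
elim: m => [|m IH] n a.
  have -> : (1%:R / (1%:R + 1) : R) = 2^-1 by rewrite mul1r -(natrD R 1 1).
  rewrite mulfV ?pnatr_eq0// mul1r powRr1 ?sup_norm_ge0//.
  apply: le_trans (sum_normc_le_sup_norm a); apply: ler_sum => x _.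
  by rewrite powR12_sqrt ?normc2_ge0// sqrtr_sqr ger0_norm ?normc_ge0.
have := @blei_inequality R m n (fun x => normc2 (a x))
  ((m.+2%:R * sup_norm a) `^ (2 * (1 - m.+2%:R^-1))) (fun x => normc2_ge0 _)
  (fun j => mixed_sum_le a j IH).
set M := m.+2%:R : R; set Z := \sum_x _; set B := M * sup_norm a.
have M0 : 0 < M by rewrite ltr0n.
have M1 : 1 < M by rewrite ltr1n.
have Mn0 := lt0r_neq0 M0.
have M1n0 : M + 1 != 0 by rewrite lt0r_neq0// addr_gt0.
have B1n0 : M - 1 != 0 by rewrite subr_eq0 (gt_eqF M1).
(* Raising Blei's bound to this power makes the exponent on the left 1. *)
have MM0 : 0 < M / (M + 1) * (1 - M^-1)^-1.
  apply: mulr_gt0; first by rewrite divr_gt0// addr_gt0.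
  by rewrite invr_gt0 subr_gt0 invf_lt1.
move/(ge0_ler_powR (ltW MM0)); rewrite !nnegrE !powR_ge0 => /(_ isT isT).
rewrite -!powRrM.
have -> : (1 - M^-1 ^+ 2) * (M / (M + 1) * (1 - M^-1)^-1) = 1.
  by clearbody M; field; rewrite ?Mn0 ?M1n0 ?B1n0.
have -> : 2 * (1 - M^-1) * (M / (M + 1) * (1 - M^-1)^-1) = 2 * (M / (M + 1)).
  by clearbody M; field; rewrite ?Mn0 ?M1n0 ?B1n0.
by rewrite powRr1// sumr_ge0// => x _; exact: powR_ge0.
Qed.

(** * The Lorentz norm *)

(** [rank] is the zero-based position in the indices sorted by decreasing modulus; it moves the
    Lorentz sum onto the index set. *)
Lemma sum_decr_rearr (R : realType) (I : finType) (x : I -> R[i]) (q : R)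
    (W : nat -> R) : exists2 rank : I -> nat, injective rank &
  \sum_(k < size (decr_rearr x)) (nth 0 (decr_rearr x) k) `^ q * W k =
    \sum_i normc (x i) `^ q * W (rank i).
Proof.
pose f i := normc (x i).
set e := sort (relpre f (fun a b : R => b <= a)) (enum I).
have memE i : i \in e by rewrite mem_sort mem_enum.
exists (index^~ e).
  by move=> i j ij; rewrite -(nth_index i (memE i)) ij nth_index.
rewrite /decr_rearr sort_map -/e size_map -[RHS]big_enum/=.
rewrite -(perm_big _ (permEl (perm_sort (relpre f (fun a b : R => b <= a)) _)))/= -/e.
have ue : uniq e by rewrite sort_uniq enum_uniq.
clearbody e; case: e ue memE => [|i0 e] ue _; first by rewrite big_ord0 big_nil.
rewrite (big_nth i0) big_mkord; apply: eq_bigr => k _.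
by rewrite (nth_map i0)// index_uniq.
Qed.

(** Since [r - 1 <= 0], [k^r = k * k^(r-1)] is at least [k * (k+1)^(r-1)]. *)
Lemma powR_succB_le (R : realType) (r : R) (k : nat) : 0 < r -> r <= 1 ->
  k.+1%:R `^ r - k%:R `^ r <= k.+1%:R `^ (r - 1).
Proof.
move=> r0 r1.
rewrite -(mulr_powRB1 (ler0n _ k.+1) r0) -(mulr_powRB1 (ler0n _ k) r0).
rewrite lerBlDr -{1}natr1 mulrDl mul1r addrC lerD2l.
case: k => [|k]; first by rewrite !mul0r.
rewrite ler_wpM2l// -opprB !powRN lef_pV2 ?posrE ?powR_gt0 ?ltr0n//.
by rewrite ge0_ler_powR ?nnegrE ?subr_ge0// ler_nat.
Qed.

Lemma lorentz_norm_le (R : realType) (m n : nat) (a : multi_index m.+2 n -> R[i])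
    (M := m.+2%:R : R) :
  lorentz_norm (2 * M / (M + 1)) (2 * (M - 1) / M) a <= M `^ 4 * sup_norm a.
Proof.
pose t := M^-1; set q := 2 * (M - 1) / M; set p := 2 * M / (M + 1).
have M0 : 0 < M by rewrite ltr0n.
have M2 : 2 <= M by rewrite ler_nat.
have Mn0 := lt0r_neq0 M0.
have M1n0 : M + 1 != 0 by rewrite lt0r_neq0// addr_gt0.
have t0 : 0 < t by rewrite invr_gt0.
have t1 : t < 1 by exact: invSS_lt1.
have t2 : t <= 2^-1 by rewrite lef_pV2 ?posrE.
have qE : q = 2 * (1 - t) by rewrite /q /t; clearbody M; field.
have q1 : 1 <= q by rewrite qE; lra.
have q0 : 0 < q by exact: lt_le_trans q1.
have qpE : q / p = 1 - t ^+ 2.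
  by rewrite /q /p /t; clearbody M; field; rewrite ?Mn0 ?M1n0.
have qp0 : 0 < 1 - t ^+ 2 by rewrite subr_gt0 expr_lt1// ltW.
rewrite /lorentz_norm/= qpE.
have [rank inj ->] := sum_decr_rearr a q
  (fun k => k.+1%:R `^ (1 - t ^+ 2) - k%:R `^ (1 - t ^+ 2)).
set s := sup_norm a.
have s0 : 0 <= s by exact: sup_norm_ge0.
have Ms0 : 0 <= M * s by rewrite mulr_ge0// ltW.
(* The 4 comes from [sum_rank_mixed], the factor [M] from the number of directions. *)
have main : \sum_x normc (a x) `^ q * ((rank x).+1%:R `^ (1 - t ^+ 2) -
    (rank x)%:R `^ (1 - t ^+ 2)) <= (4 * M) * (M * s) `^ q.
  apply: (@le_trans _ _ (\sum_x normc2 (a x) `^ (1 - t) *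
      (rank x).+1%:R `^ (- t ^+ 2))).
    apply: ler_sum => x _.
    rewrite /normc2 -[_ ^+ 2 in leRHS]powR_mulrn ?normc_ge0// -powRrM -qE.
    rewrite ler_wpM2l ?powR_ge0//.
    have := powR_succB_le (rank x) qp0; rewrite [_ - 1]addrAC subrr add0r.
    by apply; rewrite gerBl sqr_ge0.
  apply: le_trans (sum_rank_mixed inj (fun x => normc2_ge0 _)) _.
  rewrite -mulrA ler_wpM2l//.
  apply: le_trans (ler_sum _ (fun j _ =>
    mixed_sum_le a j (@bohnenblust_hille R m))) _.
  by rewrite sumr_const card_ord -[leLHS]mulr_natl qE.
have iq0 : 0 <= q^-1 by rewrite invr_ge0 ltW.
apply: le_trans (ge0_ler_powR iq0 _ _ main) _; rewrite ?nnegrE.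
- apply: sumr_ge0 => x _; rewrite mulr_ge0 ?powR_ge0// subr_ge0.
  by rewrite ge0_ler_powR ?nnegrE ?(ltW qp0)// ler_nat.
- by rewrite mulr_ge0 ?powR_ge0// mulr_ge0// ltW.
rewrite powRM ?powR_ge0 ?mulr_ge0 ?(ltW M0)// -powRrM mulfV ?lt0r_neq0// powRr1//.
rewrite mulrA ler_wpM2r//.
have M4 : 1 <= 4 * M by lra.
(* As [q >= 1], the root of [4 * M] is at most [4 * M]; then [4 <= M^2] gives the exponent 4 of the
   theorem. *)
apply: (@le_trans _ _ (4 * M * M)).
  rewrite ler_wpM2r ?(ltW M0)//; apply: ler1_powR => //.
  by rewrite invf_le1.
rewrite powR_mulrn ?(ltW M0)//.
have -> : M ^+ 4 = M ^+ 2 * M * M by ring.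
rewrite !ler_wpM2r ?(ltW M0)//.
have -> : 4 = 2 ^+ 2 :> R by ring.
by rewrite lerXn2r ?nnegrE ?(ltW M0).
Qed.

Theorem theorem4p5 (R : realType) :
  exists delta : R, 0 < delta /\
    forall m : nat, (2 <= m)%N ->
      (BH_mult (lorentz ((2 * m%:R) / (m%:R + 1)) ((2 * (m%:R - 1)) / m%:R)) m
        <= ((m%:R : R) `^ delta)%:E)%E.
Proof.
exists 4; split => // -[|[|m]] // _.
apply: ge_ereal_inf; exists (m.+2%:R `^ 4)%:E => //.
exists (m.+2%:R `^ 4) => //; split => [|n a]; last exact: lorentz_norm_le.
by rewrite powR_mulrn// exprn_ege1// ler1n.
Qed.
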